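(* There exists an absolute constant $c>0$ such that for any $\Delta>1$ and $D\ge 10^6\ln\Delta$ there exists a planar graph $G$ with diameter $\le D$, maximum degree $\le\Delta$, and a vertex $s$ such that with probability $1-o_n(1)$ we have $$h(\mathcal{T}(G,s))>c\sqrt{\Delta}\,(D+\ln n),$$ where $n$ is the number of vertices of $G$.
   Context: All graphs are finite, simple, undirected and connected. For a graph $G$ on $n$ vertices and $s\in V(G)$, build random subtrees $T_1,\dots,T_n$ of $G$: $T_1$ is the single vertex $s$, and for $1<i\le n$, $T_i$ is obtained from $T_{i-1}$ by choosing, uniformly at random, an edge of $G$ with exactly one endpoint in $T_{i-1}$ and adding it (with its other endpoint) to $T_{i-1}$. The random spanning tree $T_n$, rooted at $s$, is denoted $\mathcal{T}(G,s)$. The height $h(T)$ of a rooted tree $T$ is the maximum length (number of edges) of a root-to-leaf path. $\ln$ is the natural logarithm. The notation $o_k(1)$ denotes the set of functions $f:\mathbb{R}\to\mathbb{R}$ such that $f(k)\to0$ as $k\to\infty$. *)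

(* Defs.v *)
From HB Require Import structures.
From mathcomp Require Import all_boot all_order all_algebra.
From mathcomp Require Import all_classical all_reals all_analysis.
Import Order.TTheory GRing.Theory Num.Theory.
Import numFieldNormedType.Exports.

Set Implicit Arguments.
Unset Strict Implicit.
Unset Printing Implicit Defensive.

Local Open Scope classical_set_scope.
Local Open Scope ring_scope.

Record graph := Graph {
  vertex :> finType;
  adj : rel vertex;
  adj_sym : symmetric adj;
  adj_irr : irreflexive adj;
  adj_connected : forall x y, connect adj x y }.

Section Metric.
Variable G : graph.

Definition degree (x : G) : nat := #|[set y | adj x y]%SET|.

Definition max_degree : nat := \max_(x : G) degree x.

(* A shortest walk has fewer than #|G| edges and exists by connectedness, so
   the default value #|G| of the minimum is never reached. *)
Definition dist (x y : G) : nat :=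
  \big[minn/#|G|]_(k < #|G| |
    [exists p : k.-tuple G, path (@adj G) x p && (last x p == y)]) (k : nat).

Definition diameter : nat := \max_(x : G) \max_(y : G) dist x y.

End Metric.

(* The two orientations of an edge are drawn as the same arc, run through in
   opposite directions. *)
Definition planar (R : realType) (G : graph) : Prop :=
  exists (pt : G -> (R * R)%type) (arc : G -> G -> R -> (R * R)%type),
  [/\ injective pt,
      forall u v : G, adj u v ->
        [/\ {within `[0, 1]%classic, continuous (arc u v)},
            {in `[0, 1] &, injective (arc u v)},
            arc u v 0 = pt u, arc u v 1 = pt v &
            forall t : R, t \in `[0, 1] -> arc v u t = arc u v (1 - t)],
      forall (u v w : G) (t : R), adj u v -> t \in `]0, 1[ -> arc u v t <> pt w &
      forall (u v x y : G) (t t' : R), adj u v -> adj x y ->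
        [set u; v]%SET <> [set x; y]%SET ->
        t \in `]0, 1[ -> t' \in `]0, 1[ -> arc u v t <> arc x y t'].

(* A tree rooted at [s] is encoded by the set of its edges, each one directed
   away from the root, i.e., as a pair (parent, child). *)
Section RandomTree.
Variables (R : realType) (G : graph) (s : G).
Implicit Type T : {set G * G}.

Definition tree_vertices T : {set G} := (s |: [set a.2 | a in T])%SET.

(* Each edge with exactly one endpoint in the tree is counted once, directed
   from that endpoint to the other one. *)
Definition boundary T : {set G * G} :=
  [set a | [&& adj a.1 a.2, a.1 \in tree_vertices T &
               a.2 \notin tree_vertices T]]%SET.

(* [tree_law i T] is the probability that the tree with [i.+1] vertices,
   obtained after [i] steps, is [T]. *)
Fixpoint tree_law (i : nat) (T : {set G * G}) : R :=
  if i is j.+1 then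
    \sum_(T' : {set G * G}) tree_law j T' *
      (\sum_(a in boundary T' | T == (a |: T')%SET) #|boundary T'|%:R^-1)
  else (T == finset.set0)%:R.

Definition prob_spanning_tree (E : pred {set G * G}) : R :=
  \sum_(T : {set G * G} | E T) tree_law #|G|.-1 T.

Definition leaf T (x : G) : bool := [forall y, (x, y) \notin T].

(* Paths in a tree on vertices of [G] have fewer than #|G| edges. *)
Definition height T : nat :=
  \max_(k < #|G| | [exists p : k.-tuple G,
      path (fun x y => (x, y) \in T) s p && leaf T (last s p)]) (k : nat).

End RandomTree.

(* Main.v *)
Require Import Defs.
From HB Require Import structures.
From mathcomp Require Import all_boot all_order all_algebra.
From mathcomp Require Import all_classical all_reals all_analysis.
From mathcomp Require Import zify ring lra.
Import Order.TTheory GRing.Theory Num.Theory.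
Import numFieldNormedType.Exports.

Set Implicit Arguments.
Unset Strict Implicit.
Unset Printing Implicit Defensive.

Local Open Scope classical_set_scope.
Local Open Scope ring_scope.

(** The graph is a necklace: a chain of [L.+1] main vertices in which two
consecutive ones are joined by [q * q] internally disjoint paths of length 2,
with [q] of order [sqrt Delta].  Every [S]-th main vertex is the start of an
arm, a path of length about [D / 4], and the [q] arms end in a common hub.
With [S] about [D / 200], every vertex is within [D / 2] of the hub, although
the chain has length [2 * L], of order [q * D].

The growth process follows the edges of first-passage percolation with
independent exponential edge weights.  In that picture a bundle of [q * q]
paths of length 2 is crossed in time of order [1 / q], so the whole chain takes
time of order [S], whereas an arm is a single path and takes time of order
[D / 4].  Hence the far end of the chain joins the tree before the hub, with a
failure probability exponentially small in [D]; the tree path to it then avoids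
the hub, so it runs along the whole chain and has at least [2 * L] edges.

This comparison is made without continuous time.  A function of the state whose
total increment over the boundary edges is nonpositive is a supermartingale
whatever the holding times are.  The [potential] used here is such a function
while neither the hub nor the end of the chain is in the tree
([potential_drift]).  It is a product of two factors: one decreases as the chain
fills up, and its total increment is at most [- 1 / 2] times its value
([necklace_weight_drift]); the other is the sum over the arms of [3 / 2] to the
number of their vertices in the tree, and its total increment is at most
[1 / 2] times its value ([arms_weight_drift]).  The potential is at least 1 when
the hub is reached ([potential_hub]), so its initial value
[q * (1 + 5 / q) ^ L / (3 / 2) ^ l] bounds the failure probability
([prob_high_ge]).  This is of order [q * exp (5 * S - l * ln (3 / 2))], which is
at most [exp (- D / 20)] because [q <= Delta] and [ln Delta] is tiny compared
with [D].  The number [n] of vertices satisfies [n + 2 <= exp (D / 20)], so that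
the error term can be taken to be [1 / (2 + n)] and [ln n] is at most [D]. *)

(** * The growth process *)

Section Growth.
Variables (G : graph) (s : G).
Implicit Types (T : {set G * G}) (a : G * G).

(** The states that the process can be in after [i] steps: the support of
[tree_law], on which invariants are proved by induction. *)
Inductive grown : nat -> {set G * G} -> Prop :=
| Grown0 : grown 0 finset.set0
| GrownS i T a : grown i T -> a \in boundary s T -> grown i.+1 (a |: T)%SET.

Lemma tree_vertices0 : tree_vertices s finset.set0 = [set s]%SET.
Proof. by rewrite /tree_vertices imset0 finset.setU0. Qed.

Lemma tree_verticesU a T :
  tree_vertices s (a |: T)%SET = (a.2 |: tree_vertices s T)%SET.
Proof. by rewrite /tree_vertices imsetU1 finset.setUCA. Qed.

Lemma root_in_tree T : s \in tree_vertices s T.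
Proof. exact: finset.setU11. Qed.

Lemma boundaryP a T :
  reflect [/\ adj a.1 a.2, a.1 \in tree_vertices s T &
              a.2 \notin tree_vertices s T] (a \in boundary s T).
Proof. by rewrite [a \in _]finset.in_set; apply: and3P. Qed.

Lemma grown_adj i T a : grown i T -> a \in T -> adj a.1 a.2.
Proof.
elim=> [|{}i {}T b _ IH /boundaryP[hb _ _]]; first by rewrite finset.inE.
by rewrite !finset.inE => /orP[/eqP->|].
Qed.

Lemma grown_parent i T a : grown i T -> a \in T -> a.1 \in tree_vertices s T.
Proof.
elim=> [|{}i {}T b _ IH /boundaryP[_ hb _]]; first by rewrite finset.inE.
rewrite tree_verticesU !finset.inE => /orP[/eqP->|/IH h]; apply/orP; right.
  by move: hb; rewrite !finset.inE.
by move: h; rewrite !finset.inE.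
Qed.

Lemma child_in_tree a T : a \in T -> a.2 \in tree_vertices s T.
Proof. by move=> aT; apply/setU1P; right; apply/imsetP; exists a. Qed.

Lemma card_grown i T : grown i T -> #|tree_vertices s T| = i.+1.
Proof.
elim=> [|{}i {}T a _ IH /boundaryP[_ _ ha]].
  by rewrite tree_vertices0 cards1.
by rewrite tree_verticesU cardsU1 ha IH.
Qed.

(** Connectedness keeps the process from getting stuck, so that no mass is lost. *)
Lemma boundary_neq0 i T : grown i T -> (i < #|G|.-1)%N ->
  boundary s T != finset.set0.
Proof.
move=> gT lti; apply/negP => /eqP b0.
have cl : fingraph.closed (@adj G) (mem (tree_vertices s T)).
  apply: (intro_closed (sym_connect_sym (@adj_sym G))) => x y xy xV.
  apply/negP => /negP yV; have : (x, y) \in boundary s T by apply/boundaryP.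
  by rewrite b0 finset.inE.
have VT : tree_vertices s T = [set: G]%SET.
  apply/setP=> y; rewrite [RHS]finset.inE.
  by rewrite -(closed_connect cl (adj_connected s y)) root_in_tree.
have := card_grown gT; rewrite VT cardsT => e.
by move: lti; rewrite e /= ltnn.
Qed.

Lemma grown_path i T x : grown i T -> x \in tree_vertices s T ->
  exists2 p, path (fun u v => (u, v) \in T) s p & last s p = x.
Proof.
move=> gT; elim: gT x => [|{}i {}T a _ IH /boundaryP[_ ha _]] x.
  by rewrite tree_vertices0 => /set1P->; exists [::].
have mono y p : path (fun u v => (u, v) \in T) y p ->
    path (fun u v => (u, v) \in (a |: T)%SET) y p.
  by apply: sub_path => u v uv; rewrite finset.inE uv orbT.
rewrite tree_verticesU => /setU1P[->|/IH[p pp <-]]; last first.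
  by exists p => //; apply: mono.
have [p pp lp] := IH _ ha; exists (rcons p a.2); last by rewrite last_rcons.
by rewrite rcons_path mono //= lp -surjective_pairing finset.setU11.
Qed.

Lemma tree_path_vertices T p : path (fun u v => (u, v) \in T) s p ->
  {subset p <= tree_vertices s T}.
Proof.
elim/last_ind: p => // p y IH; rewrite rcons_path => /andP[pp hy] x.
rewrite mem_rcons inE => /orP[/eqP->|]; last exact: IH.
exact: (child_in_tree hy).
Qed.

(** A depth function certifies that parent-to-child paths never cycle; the bound
by [i] holds since each step creates at most one new level. *)
Lemma grown_depth i T : grown i T -> exists d : G -> nat,
  [/\ d s = 0%N, forall a, a \in T -> d a.2 = (d a.1).+1 &
      forall x, (d x <= i)%N].
Proof.
elim=> [|{}i {}T a gT [d [ds dT di]] /boundaryP[_ ha1 ha2]].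
  by exists (fun=> 0%N); split=> // a; rewrite finset.inE.
have neq x : x \in tree_vertices s T -> (x == a.2) = false.
  by move=> xT; apply: contraNF ha2 => /eqP<-.
exists (fun x => if x == a.2 then (d a.1).+1 else d x); split.
- by rewrite neq ?root_in_tree.
- move=> b /setU1P[->|bT]; first by rewrite eqxx neq.
  by rewrite !neq ?dT ?(child_in_tree bT) ?(grown_parent gT bT).
- by move=> x; case: ifP => _; rewrite ?ltnS // leqW.
Qed.

(** [height] only sees paths that end in a leaf; any other path can be prolonged,
and this stops because depth grows along it. *)
Lemma path_le_height i T p : grown i T -> (i < #|G|)%N ->
  path (fun u v => (u, v) \in T) s p -> (size p <= height s T)%N.
Proof.
move=> gT lti; have [d [ds dT di]] := grown_depth gT.
have dlast q : path (fun u v => (u, v) \in T) s q -> d (last s q) = size q.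
  elim/last_ind: q => [|q y IH]; first by rewrite /= ds.
  by rewrite rcons_path last_rcons size_rcons => /andP[/IH<- /dT].
have size_lt q : path (fun u v => (u, v) \in T) s q -> (size q < #|G|)%N.
  by move=> pq; rewrite -dlast //; apply: leq_ltn_trans lti.
have [k hk] := ubnP (#|G| - size p)%N.
elim: k p hk => // k IH p hk pp.
have szp := size_lt _ pp.
have [lp|/forallPn[y]] := boolP (leaf T (last s p)).
  have /= := @leq_bigmax_cond _ (fun k : 'I_#|G| => [exists p : k.-tuple G,
      path (fun x y => (x, y) \in T) s p && leaf T (last s p)])
      (fun k => k : nat) (Ordinal szp).
  apply; apply/existsP; exists (in_tuple p) => /=.
  by rewrite pp lp.
rewrite negbK => hy.
have pq : path (fun u v => (u, v) \in T) s (rcons p y) by rewrite rcons_path pp.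
have := IH (rcons p y); rewrite size_rcons => IHp.
by apply: ltnW; apply: IHp => //; lia.
Qed.

Variable R : realType.

Lemma tree_law_ge0 i T : 0 <= tree_law R s i T.
Proof.
elim: i T => [|i IH] T /=; first exact: ler0n.
by apply: sumr_ge0 => T' _; apply: mulr_ge0 => //; apply: sumr_ge0 => a _;
  rewrite invr_ge0.
Qed.

Lemma tree_law_grown i T : tree_law R s i T != 0 -> grown i T.
Proof.
elim: i T => [|i IH] T /=.
  by case: (T =P _) => [-> _|_ /eqP //]; constructor.
apply: contra_neqP => nT; apply: big1 => T' _.
have [/IH gT'|/negbNE/eqP->] := boolP (tree_law R s i T' != 0); last first.
  by rewrite mul0r.
rewrite big1 ?mulr0 // => a /andP[aT' /eqP eT].
by case: nT; rewrite eT; constructor.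
Qed.

Lemma tree_lawS i T :
  tree_law R s i.+1 T = \sum_(T' : {set G * G}) tree_law R s i T' *
    (\sum_(a in boundary s T' | T == (a |: T')%SET) #|boundary s T'|%:R^-1).
Proof. by []. Qed.

(** The law of the next edge is uniform on the boundary, so a function whose mean
over the boundary dominates its value grows in expectation. *)
Lemma submartingale_le (F : {set G * G} -> R) :
  (forall i T, grown i T ->
    #|boundary s T|%:R * F T <= \sum_(a in boundary s T) F (a |: T)%SET) ->
  forall i, (i < #|G|)%N -> F finset.set0 <= \sum_T tree_law R s i T * F T.
Proof.
move=> subF; elim=> [|i IH] lti.
  rewrite (bigD1 finset.set0) //= eqxx mul1r big1 ?addr0 // => T /negPf->.
  by rewrite mul0r.
apply: (le_trans (IH (ltnW lti))).
under [leRHS]eq_bigr do rewrite tree_lawS mulr_suml.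
rewrite exchange_big; apply: ler_sum => T _.
have [/tree_law_grown gT|/negbNE/eqP->] := boolP (tree_law R s i T != 0).
  2: by rewrite mul0r big1 // => T' _; rewrite !mul0r.
have b0 : boundary s T != finset.set0 by apply: (boundary_neq0 gT); lia.
under [leRHS]eq_bigr do rewrite -mulrA.
rewrite -mulr_sumr ler_wpM2l ?tree_law_ge0 //.
under eq_bigr do rewrite mulr_suml big_mkcondr /=.
rewrite exchange_big /=.
under eq_bigr => a _.
  rewrite -big_mkcond /= (big_pred1 (a |: T)%SET) //; over.
rewrite -mulr_sumr mulrC ler_pdivlMr ?ltr0n ?card_gt0 // mulrC.
exact: subF gT.
Qed.

Lemma submartingale_prob (F : {set G * G} -> R) (E : pred {set G * G}) :
  (forall i T, grown i T ->
    #|boundary s T|%:R * F T <= \sum_(a in boundary s T) F (a |: T)%SET) ->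
  (forall T, grown #|G|.-1 T -> F T <= (E T)%:R) ->
  F finset.set0 <= prob_spanning_tree R s E.
Proof.
move=> subF FE; have n0 : (0 < #|G|)%N by apply/card_gt0P; exists s.
have lt_n : (#|G|.-1 < #|G|)%N by rewrite prednK.
apply: (le_trans (submartingale_le subF lt_n)).
rewrite /prob_spanning_tree [leRHS]big_mkcond; apply: ler_sum => T _.
have [/tree_law_grown/FE FT|/negbNE/eqP->] :=
  boolP (tree_law R s #|G|.-1 T != 0); last by rewrite mul0r; case: ifP.
apply: (le_trans (ler_wpM2l (tree_law_ge0 _ _) FT)).
by case: (E T); rewrite ?mulr1 ?mulr0.
Qed.

End Growth.

(** * Bounding the diameter *)

Section Distances.
Variable G : graph.

Lemma bigmin_nat_le (I : eqType) (r : seq I) (P : pred I) (F : I -> nat) x0 :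
  (\big[minn/x0]_(i <- r | P i) F i <= x0)%N /\
  (forall i, i \in r -> P i -> (\big[minn/x0]_(i <- r | P i) F i <= F i)%N).
Proof.
elim: r => [|j r [IH0 IH]]; first by rewrite big_nil.
rewrite big_cons; case: ifP => Pj; split=> [|i].
- by rewrite geq_min IH0 orbT.
- rewrite inE => /orP[/eqP->|ir] Pi; first by rewrite geq_minl.
  by rewrite geq_min IH ?orbT.
- exact: IH0.
- by rewrite inE => /orP[/eqP->|ir] Pi; [rewrite Pi in Pj | apply: IH].
Qed.

(** A path with at least [#|G|] edges also bounds the distance, because the default
value of the minimum is [#|G|]. *)
Lemma dist_le_path (x y : G) p :
  path (@adj G) x p -> last x p = y -> (dist x y <= size p)%N.
Proof.
move=> pp lp; rewrite /dist.
have [lt_p|/(leq_trans _)] := ltnP (size p) #|G|; last first.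
  by apply; apply: (bigmin_nat_le _ _ _ _).1.
apply: ((bigmin_nat_le _ _ _ _).2 (Ordinal lt_p)); first exact: mem_index_enum.
by apply/existsP; exists (in_tuple p); rewrite /= pp lp eqxx.
Qed.

Lemma path_of_descent (T : eqType) (e : rel T) (h : T) (d : T -> nat) :
  (forall x, x != h -> exists2 y, e x y & (d y < d x)%N) ->
  forall x, exists p, [/\ path e x p, last x p = h & (size p <= d x)%N].
Proof.
move=> desc x; have [k] := ubnP (d x); elim: k x => // k IH x dx.
have [->|/desc[y xy yx]] := eqVneq x h; first by exists [::].
have [|p [pp lp sp]] := IH y; first by rewrite (leq_trans yx).
by exists (y :: p); rewrite /= xy; split=> //; apply: leq_ltn_trans yx.
Qed.

Lemma diameter_le_hub (h : G) b :
  (forall x, exists p, [/\ path (@adj G) x p, last x p = h & (size p <= b)%N]) ->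
  (diameter G <= b.*2)%N.
Proof.
move=> hp; apply/bigmax_leqP => x _; apply/bigmax_leqP => y _.
have [p [pp lp sp]] := hp x; have [q [pq lq sq]] := hp y.
have symG : symmetric (@adj G) := @adj_sym G.
have := @dist_le_path x y (p ++ rev (belast y q)).
rewrite size_cat size_rev size_belast => H; rewrite -addnn.
apply: leq_trans (leq_add sp sq); apply: H.
  rewrite cat_path pp lp -lq rev_path.
  by rewrite (eq_path (e' := @adj G)) // => u v; rewrite symG.
by rewrite last_cat lp -lq; case: (q) => //= z r; rewrite rev_cons last_rcons.
Qed.

End Distances.

(** * The necklace *)

(** [Main i] are the vertices of the chain, [Middle i m] the midpoints of the paths
from [Main i] to [Main i.+1], and [Arm j k] the interior vertices of the arms,
numbered towards the hub. *)
Inductive node (L M J l : nat) :=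
| Main of 'I_L.+1
| Middle of 'I_L & 'I_M
| Arm of 'I_J & 'I_l
| Hub.
Arguments Main {L M J l}.
Arguments Middle {L M J l}.
Arguments Arm {L M J l}.
Arguments Hub {L M J l}.

Section NodeFintype.
Variables L M J l : nat.

Definition node_code (x : node L M J l) :
    'I_L.+1 + ('I_L * 'I_M + ('I_J * 'I_l + unit)) :=
  match x with
  | Main i => inl i
  | Middle i m => inr (inl (i, m))
  | Arm j k => inr (inr (inl (j, k)))
  | Hub => inr (inr (inr tt))
  end.

Definition node_decode
    (c : 'I_L.+1 + ('I_L * 'I_M + ('I_J * 'I_l + unit))) : node L M J l :=
  match c with
  | inl i => Main i
  | inr (inl (i, m)) => Middle i m
  | inr (inr (inl (j, k))) => Arm j k
  | inr (inr (inr _)) => Hub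
  end.

Lemma node_codeK : cancel node_code node_decode.
Proof. by case. Qed.

HB.instance Definition _ := Finite.copy (node L M J l) (can_type node_codeK).

Lemma card_node : #|{: node L M J l}| = (L.+1 + (L * M + (J * l + 1)))%N.
Proof.
have bij : bijective node_code.
  by exists node_decode => [|[i|[[i m]|[[j k]|[]]]]] //; apply: node_codeK.
by rewrite (bij_eq_card bij) !card_sum !card_prod !card_ord card_unit.
Qed.

End NodeFintype.

Section Necklace.
Variables L M J S l : nat.
Notation node := (node L M J l).
Implicit Types x y : node.

(** Each edge is listed in one direction, towards the end of the chain or towards
the hub.  The [j]-th arm starts at [Main (j * S)]. *)
Definition link x y : bool :=
  match x, y with
  | Main i, Middle i' _ => i' == i :> nat
  | Middle i _, Main i' => i' == i.+1 :> nat
  | Main i, Arm j k => (i == j * S :> nat)%N && (k == 0 :> nat)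
  | Arm j k, Arm j' k' => (j' == j) && (k' == k.+1 :> nat)
  | Arm _ k, Hub => k.+1 == l
  | _, _ => false
  end.

Definition necklace_adj x y := link x y || link y x.

Lemma necklace_sym : symmetric necklace_adj.
Proof. by move=> x y; rewrite /necklace_adj orbC. Qed.

Lemma necklace_irr : irreflexive necklace_adj.
Proof.
move=> [i|i m|j k|]; rewrite /necklace_adj //= eqxx /=.
by rewrite orbb ltn_eqF.
Qed.

Hypotheses (M_gt0 : (0 < M)%N) (l_gt0 : (0 < l)%N) (LJS : L.+1 = (J * S)%N).

Let S_gt0 : (0 < S)%N. Proof. by case: S LJS => //; rewrite muln0. Qed.

(** The length of the route to the hub that goes back along the chain to the start
of the segment and then follows its arm. *)
Definition hub_dist x : nat :=
  match x with
  | Main i => (i %% S).*2 + l.+1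
  | Middle i m => (i %% S).*2 + l.+2
  | Arm j k => l - k
  | Hub => 0
  end.

Lemma hub_descent x : x != Hub ->
  exists2 y, necklace_adj x y & (hub_dist y < hub_dist x)%N.
Proof.
case: x => [i|i m|j k|] // _; rewrite /necklace_adj.
- have [iS|iS] := eqVneq (i %% S)%N 0%N.
    have ltJ : (i %/ S < J)%N by rewrite ltn_divLR // -LJS.
    exists (Arm (Ordinal ltJ) (Ordinal l_gt0)) => /=; last by lia.
    by rewrite eqxx andbT orbF {1}(divn_eq i S) iS addn0.
  have i_gt0 : (0 < i)%N by case: (i : nat) iS => //; rewrite mod0n.
  have ltL : (i.-1 < L)%N by have := ltn_ord i; lia.
  exists (Middle (Ordinal ltL) (Ordinal M_gt0)) => /=; first by rewrite prednK ?eqxx ?orbT.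
  have -> : (i %% S = (i.-1 %% S).+1)%N.
    rewrite -{1}(prednK i_gt0) modnS; case: ifP => // /dvdnP [q eq].
    by move: iS; rewrite -(prednK i_gt0) eq modnMl.
  by lia.
- by exists (Main (widen_ord (leqnSn L) i)) => /=; [rewrite eqxx orbT | lia].
- have [e|ne] := eqVneq k.+1 l; first by exists Hub => //=; rewrite ?e ?eqxx //; lia.
  have ltl : (k.+1 < l)%N by have := ltn_ord k; lia.
  by exists (Arm j (Ordinal ltl)) => /=; rewrite ?eqxx //=; lia.
Qed.

Lemma hub_dist_le x : (hub_dist x <= S.*2 + l)%N.
Proof.
have mS i : (i %% S < S)%N by rewrite ltn_mod.
by case: x => [i|i m|j k|] /=; rewrite ?(leq_trans (leq_subr _ _) (leq_addl _ _)) //;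
  have := mS i; lia.
Qed.

Lemma necklace_to_hub x : exists p,
  [/\ path necklace_adj x p, last x p = Hub & (size p <= S.*2 + l)%N].
Proof.
have [p [pp lp sp]] := path_of_descent hub_descent x.
by exists p; split=> //; apply: leq_trans (hub_dist_le x).
Qed.

Lemma necklace_connected x y : connect necklace_adj x y.
Proof.
have toH z : connect necklace_adj z Hub.
  by have [p [pp lp _]] := necklace_to_hub z; apply/connectP; exists p.
by apply: connect_trans (toH x) _; rewrite (sym_connect_sym necklace_sym).
Qed.

Definition necklace : graph := Graph necklace_sym necklace_irr necklace_connected.

Lemma diameter_necklace : (diameter necklace <= (S.*2 + l).*2)%N.
Proof. exact: (@diameter_le_hub necklace Hub _ necklace_to_hub). Qed.

End Necklace.

(** * Degrees *)

Section NecklaceDegree.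
Variables L M J S l : nat.
Hypotheses (M_gt0 : (0 < M)%N) (l_gt0 : (0 < l)%N) (LJS : L.+1 = (J * S)%N).
Notation node := (node L M J l).
Notation necklace := (necklace M_gt0 l_gt0 LJS).

(** Untyped coordinates, in which neighbours can be listed without building
ordinals. *)
Definition flat (x : node) : nat * nat * nat :=
  match x with
  | Main i => (0, i : nat, 0)%N
  | Middle i m => (1, i : nat, m : nat)%N
  | Arm j k => (2, j : nat, k : nat)%N
  | Hub => (3, 0, 0)%N
  end.

Lemma flat_inj : injective flat.
Proof.
case=> [i|i m|j k|] [i'|i' m'|j' k'|] //= [].
- by move=> /ord_inj->.
- by move=> /ord_inj-> /ord_inj->.
- by move=> /ord_inj-> /ord_inj->.
Qed.

Definition flat_neighbours (x : node) : seq (nat * nat * nat) :=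
  match x with
  | Main i => [seq (1, i : nat, m)%N | m <- iota 0 M] ++
      (if (0 < i)%N then [seq (1, i.-1, m)%N | m <- iota 0 M] else [::]) ++
      (if (i %% S == 0)%N then [:: (2, i %/ S, 0)%N] else [::])
  | Middle i m => [:: (0, i : nat, 0)%N; (0, i.+1, 0)%N]
  | Arm j k => [:: if k == 0 :> nat then (0, j * S, 0)%N else (2, j : nat, k.-1)%N;
                   if k.+1 == l then (3, 0, 0)%N else (2, j : nat, k.+1)%N]
  | Hub => [seq (2, j, l.-1)%N | j <- iota 0 J]
  end.

Lemma flat_neighbours_adj x y : necklace_adj S x y -> flat y \in flat_neighbours x.
Proof.
have S_gt0 : (0 < S)%N by case: S LJS => //; rewrite muln0.
have map_iota (T : eqType) (f : nat -> T) n k : (k < n)%N -> f k \in [seq f m | m <- iota 0 n].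
  by move=> kn; rewrite map_f // mem_iota.
rewrite /necklace_adj; case: x y => [i|i m|j k|] [i'|i' m'|j' k'|] //=;
  rewrite ?orbF ?mem_cat.
- case/orP=> /eqP e; first by rewrite e (map_iota _ (fun m => (1, i : nat, m)%N)).
  by rewrite e /= (map_iota _ (fun m => (1, i' : nat, m)%N)) ?orbT.
- by case/andP=> /eqP-> /eqP->; rewrite modnMl mulnK //= mem_seq1 eqxx !orbT.
- by rewrite !inE => /orP[] /eqP->; rewrite eqxx ?orbT.
- by case/andP=> /eqP-> /eqP->; rewrite !inE eqxx.
- case/orP=> /andP[/eqP-> /eqP e]; rewrite !inE e //=.
    by rewrite (_ : (k.+1 == l) = false) ?eqxx ?orbT // -e ltn_eqF.
  by rewrite eqxx.
- by move=> ->; rewrite !inE eqxx orbT.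
- by move=> /eqP e; rewrite -[k' : nat]/(k'.+1.-1) e; apply: (map_iota _ (fun j => (2, j, l.-1)%N)).
Qed.

(** When there is a single arm, it starts at an end of the chain, whose degree is
only [M.+1]; this matters for [Delta = 2]. *)
Lemma max_degree_necklace Delta : (1 < Delta)%N -> (J <= Delta)%N ->
  (M.*2 + (1 < J)%N <= Delta)%N -> (max_degree necklace <= Delta)%N.
Proof.
move=> D2 JD MD; apply/bigmax_leqP => x _.
apply: (@leq_trans (size (flat_neighbours x))).
  rewrite /degree cardE -(size_map flat); apply: uniq_leq_size.
    by rewrite (map_inj_uniq flat_inj) enum_uniq.
  by move=> _ /mapP[y + ->]; rewrite mem_enum finset.inE => /flat_neighbours_adj.
case: x => [i|i m|j k|] //=; rewrite ?size_map ?size_iota //.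
rewrite !size_cat size_map size_iota.
have iJS : (i < J * S)%N by rewrite -LJS.
case: ifP => i0; case: ifP => iS; rewrite ?size_map ?size_iota //=; try lia.
suff : (1 < J)%N by lia.
rewrite ltnNge; apply/negP => J1; move/eqP: iS; rewrite modn_small; first lia.
by apply: leq_trans iJS _; rewrite -[leqRHS]mul1n leq_mul2r J1 orbT.
Qed.

End NecklaceDegree.

(** * Planarity *)

Section StraightLineDrawings.
Variable R : realType.
Implicit Types p q : (R * R)%type.

Definition segment p q (t : R) : (R * R)%type :=
  ((1 - t) * p.1 + t * q.1, (1 - t) * p.2 + t * q.2).

Lemma segmentC p q t : segment p q t = segment q p (1 - t).
Proof. by rewrite /segment; congr pair; ring. Qed.

Lemma segment_inj p q : p <> q -> injective (segment p q).
Proof.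
case: p q => [a b] [a' b'] neq t t' [/= e1 e2].
have [//|tt'] := eqVneq t t'; case: neq.
have inj (x y : R) : (1 - t) * x + t * y = (1 - t') * x + t' * y -> x = y.
  move=> e; apply/eqP; rewrite -subr_eq0.
  have /eqP : (t' - t) * (x - y) = 0.
    by rewrite -[RHS](subrr ((1 - t) * x + t * y)) {2}e; ring.
  by rewrite mulf_eq0 => /orP[|//] /eqP/subr0_eq e'; rewrite e' eqxx in tt'.
by rewrite (inj _ _ e1) (inj _ _ e2).
Qed.

Lemma segment_continuous p q : continuous (segment p q).
Proof.
have aff (x y : R) : continuous (fun t : R => (1 - t) * x + t * y).
  move=> t; apply: cvgD; apply: cvgM; try exact: cvg_cst; last exact: cvg_id.
  by apply: cvgB; [exact: cvg_cst | exact: cvg_id].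
by move=> t; exact: cvg_pair (aff p.1 q.1 t) (aff p.2 q.2 t).
Qed.

Lemma planar_straight (G : graph) (e : rel G) (pt : G -> (R * R)%type) :
  (forall u v, adj u v = e u v || e v u) -> injective pt ->
  (forall u v w (t : R), e u v -> 0 < t < 1 -> segment (pt u) (pt v) t <> pt w) ->
  (forall u v x y (t t' : R), e u v -> e x y -> 0 < t < 1 -> 0 < t' < 1 ->
     segment (pt u) (pt v) t = segment (pt x) (pt y) t' -> u = x /\ v = y) ->
  planar R G.
Proof.
move=> adjE pt_inj off disj; exists pt, (fun u v => segment (pt u) (pt v)).
have rev01 (t : R) : 0 < t < 1 -> 0 < 1 - t < 1 by lra.
split=> // [u v uv|u v w t|u v x y t t'].
- split.
  + by apply: continuous_subspaceT; apply: segment_continuous.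
  + move=> t t' _ _; apply: segment_inj => /pt_inj eq_uv.
    by rewrite eq_uv adj_irr in uv.
  + by rewrite /segment; case: (pt u) => a b /=; congr pair; ring.
  + by rewrite /segment; case: (pt v) => a b /=; congr pair; ring.
  + by move=> t _; rewrite segmentC.
- rewrite adjE in_itv /= => /orP[uv t01|vu /rev01 t01]; first exact: off.
  by rewrite segmentC; apply: off.
- rewrite !adjE !in_itv /= => uv xy neq t01 t01' eq; case: neq.
  case/orP: uv => [uv|vu]; case/orP: xy => [xy|yx].
  + by have [-> ->] := disj _ _ _ _ _ _ uv xy t01 t01' eq.
  + rewrite (segmentC (pt x)) in eq.
    have [-> ->] := disj _ _ _ _ _ _ uv yx t01 (rev01 _ t01') eq.
    by rewrite finset.setUC.
  + rewrite (segmentC (pt u)) in eq.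
    have [-> ->] := disj _ _ _ _ _ _ vu xy (rev01 _ t01) t01' eq.
    by rewrite finset.setUC.
  + rewrite (segmentC (pt u)) (segmentC (pt x)) in eq.
    by have [-> ->] := disj _ _ _ _ _ _ vu yx (rev01 _ t01) (rev01 _ t01') eq.
Qed.

End StraightLineDrawings.

Section NecklacePlanar.
Variables (R : realType) (L M J S l : nat).
Hypotheses (M_gt0 : (0 < M)%N) (l_gt0 : (0 < l)%N) (LJS : L.+1 = (J * S)%N).
Notation node := (node L M J l).
Notation necklace := (necklace M_gt0 l_gt0 LJS).

(** The segment from [Main (j * S)], at parameter 0, to the hub, at parameter 1. *)
Definition spoke (j : nat) (t : R) : (R * R)%type := ((j * S).*2%:R * (1 - t), - t).

(** The chain is drawn in the upper half-plane, with the midpoints of each bundle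
on a vertical line, and the arms lie on straight spokes in the lower half-plane
that meet only at the hub. *)
Definition position (x : node) : (R * R)%type :=
  match x with
  | Main i => (i.*2%:R, 0)
  | Middle i m => (i.*2.+1%:R, m%:R)
  | Arm j k => spoke j (k.+1%:R / l.+1%:R)
  | Hub => (0, -1)
  end.

Lemma nat_frac_inj (k k' : nat) (t t' : R) : 0 <= t < 1 -> 0 <= t' < 1 ->
  k%:R + t = k'%:R + t' -> k = k'.
Proof.
move=> /andP[t0 t1] /andP[t0' t1'] e.
have lt1 (m n : nat) : (m < n)%N -> m%:R + 1 <= n%:R :> R.
  by rewrite natr1 ler_nat.
by have [/lt1 kk'|/lt1 kk'|//] := ltngtP k k'; exfalso; lra.
Qed.

Lemma frac_not_nat (k k' : nat) (t : R) : 0 < t < 1 -> k%:R + t <> k'%:R.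
Proof.
move=> t01 e; have k'E : k%:R + t = k'%:R + 0 by rewrite addr0.
have ek : k = k' by apply: nat_frac_inj k'E; lra.
by move: e; rewrite ek; lra.
Qed.

Let S_gt0 : (0 < S)%N. Proof. by case: S LJS => //; rewrite muln0. Qed.

Lemma spoke_inj j j' t t' : t < 1 -> spoke j t = spoke j' t' -> t = t' /\ j = j'.
Proof.
move=> t1 [/[swap] /oppr_inj <- /mulIf]; rewrite subr_eq0 gt_eqF // => /(_ isT).
by move=> /eqP; rewrite eqr_nat => /eqP e; split=> //; nia.
Qed.

Lemma position_inj : injective position.
Proof.
have l1 : 0 < l.+1%:R :> R by rewrite ltr0n.
have lt1 (k : 'I_l) : k.+1%:R / l.+1%:R < 1 :> R.
  by rewrite ltr_pdivrMr // mul1r ltr_nat ltnS.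
have gt0 (k : 'I_l) : 0 < k.+1%:R / l.+1%:R :> R by rewrite divr_gt0 ?ltr0n.
have m0 (m : nat) : 0 <= m%:R :> R by [].
case=> [i|i m|j k|] [i'|i' m'|j' k'|] //=.
- by case=> /eqP; rewrite eqr_nat => /eqP e; congr Main; apply: ord_inj; lia.
- by case=> /eqP; rewrite eqr_nat => /eqP e; exfalso; lia.
- by case=> _ e; exfalso; move: e (gt0 k'); move: (k'.+1%:R / _ : R) => z; lra.
- by case=> _ e; exfalso; lra.
- by case=> /eqP; rewrite eqr_nat => /eqP e; exfalso; lia.
- case=> /eqP + /eqP; rewrite !eqr_nat => /eqP e /eqP /ord_inj ->.
  by congr Middle; apply: ord_inj; lia.
- by case=> _ e; exfalso; move: e (gt0 k') (m0 m); move: (k'.+1%:R / _ : R) => z; lra.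
- by case=> _ e; exfalso; have := m0 m; lra.
- by case=> _ e; exfalso; move: e (gt0 k); move: (k.+1%:R / _ : R) => z; lra.
- by case=> _ e; exfalso; move: e (gt0 k) (m0 m'); move: (k.+1%:R / _ : R) => z; lra.
- move=> /(spoke_inj (lt1 k))[/(mulIf _)]; rewrite invr_eq0 gt_eqF //.
  by move=> /(_ isT) /eqP; rewrite eqr_nat => /eqP[/ord_inj->] /ord_inj->.
- by case=> _ e; exfalso; move: e (lt1 k); move: (k.+1%:R / _ : R) => z; lra.
- by case=> _ e; exfalso; lra.
- by case=> _ e; exfalso; have := m0 m'; lra.
- by case=> _ e; exfalso; move: e (lt1 k'); move: (k'.+1%:R / _ : R) => z; lra.
Qed.

(** The interior points of an edge determine the edge: on the chain, the column [h]
is the integer part of the abscissa, and the slope then gives [m]; in the lower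
half-plane, the spoke [j] is determined by the point, and [k] is the integer part
of the rescaled parameter along it. *)
Variant link_spec (u v : node) (t : R) : Prop :=
| ChainLink (h m : nat) of
    segment (position u) (position v) t =
      (h%:R + t, m%:R * (if odd h then 1 - t else t))
    & flat u = (if odd h then (1, h./2, m)%N else (0, h./2, 0)%N)
    & flat v = (if odd h then (0, h./2.+1, 0)%N else (1, h./2, m)%N)
| SpokeLink (j k : nat) of (k <= l)%N &
    segment (position u) (position v) t = spoke j ((k%:R + t) / l.+1%:R)
    & flat u = (if k == 0%N then (0, j * S, 0)%N else (2, j, k.-1)%N)
    & flat v = (if k == l then (3, 0, 0)%N else (2, j, k)%N).

Lemma linkP (u v : node) t : link S u v -> link_spec u v t.
Proof.
have l0 : l.+1%:R != 0 :> R by rewrite pnatr_eq0.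
have lE : l.+1%:R = l%:R + 1 :> R by rewrite -natr1.
case: u v => [i|i m|j k|] [i'|i' m'|j' k'|] //=.
- move=> /eqP e; apply: (@ChainLink _ _ _ i.*2 m'); rewrite /= ?odd_double ?doubleK ?e //.
  by rewrite /segment /= -?natr1; congr pair; ring.
- move=> /andP[/eqP ei /eqP ek]; apply: (@SpokeLink _ _ _ j' 0) => //=.
  + rewrite /segment /spoke /= ei ek; congr pair; field; lra.
  + by rewrite ei.
  + by rewrite ek ltn_eqF.
- move=> /eqP e; apply: (@ChainLink _ _ _ i.*2.+1 m); rewrite /= ?odd_double ?uphalf_double ?e //.
  by rewrite /segment /= doubleS -?natr1; congr pair; ring.
- move=> /andP[/eqP -> /eqP e]; apply: (@SpokeLink _ _ _ j k.+1) => //=.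
  + rewrite /segment /spoke /= e -!natr1; congr pair; field; lra.
  + by rewrite -e ltn_eqF.
- move=> /eqP e; apply: (@SpokeLink _ _ _ j k.+1) => //=; last by rewrite e eqxx.
  rewrite /segment /spoke /= e -!natr1; congr pair; field; lra.
Qed.

Lemma chain_height_ge0 (m : nat) (b : bool) (t : R) :
  0 < t < 1 -> 0 <= m%:R * (if b then 1 - t else t).
Proof. by move=> t01; rewrite mulr_ge0 //; case: b; lra. Qed.

Lemma spoke_param (k : nat) (t : R) : (k <= l)%N -> 0 < t < 1 ->
  0 < (k%:R + t) / l.+1%:R < 1.
Proof.
move=> kl t01; have k0 : 0 <= k%:R :> R by [].
have l1 : 0 < l.+1%:R :> R by rewrite ltr0n.
rewrite divr_gt0 /=; [|lra|lra].
rewrite ltr_pdivrMr // mul1r -natr1; move: kl; rewrite -(ler_nat R); lra.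
Qed.

Lemma planar_necklace : planar R necklace.
Proof.
apply: (@planar_straight R necklace (@link L M J S l) position) => //.
- exact: position_inj.
- move=> u v w t /(linkP t)[h m -> _ _|j k kl -> _ _] t01.
    have := chain_height_ge0 m (odd h) t01.
    case: w => [i|i m'|j k|] /= y0 [].
    + by move=> /(frac_not_nat t01).
    + by move=> /(frac_not_nat t01).
    + by move=> _ e; move: y0; rewrite e oppr_ge0 leNgt divr_gt0 ?ltr0n.
    + by move=> _ e; move: y0; rewrite e oppr_ge0 ler10.
  have p01 := spoke_param kl t01; case/andP: (p01) => p0 p1.
  case: w => [i|i m|j' k'|] /=.
  + by case=> _ /eqP; rewrite oppr_eq0 gt_eqF.
  + case=> _ e; have : 0 <= m%:R :> R by [].
    by rewrite -e oppr_ge0 leNgt p0.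
  + move=> /(spoke_inj p1)[/(mulIf _)]; rewrite invr_eq0 pnatr_eq0 => /(_ isT).
    by move=> /(frac_not_nat t01).
  + by case=> _ /oppr_inj e; move: p1; rewrite e ltxx.
- have frac01 (t : R) : 0 < t < 1 -> 0 <= t < 1 by lra.
  move=> u v x y t t' /(linkP t)[h m -> fu fv|j k kl -> fu fv];
    move=> /(linkP t')[h' m' -> fx fy|j' k' kl' -> fx fy] t01 t01'.
  + case=> e1 e2; have eh := nat_frac_inj (frac01 _ t01) (frac01 _ t01') e1.
    have et : t = t' by move: e1; rewrite eh => /addrI.
    have em : m = m'.
      move: e2; rewrite eh et => /mulIf H; apply/eqP; rewrite -(eqr_nat R).
      by apply/eqP/H; case: (odd h'); rewrite gt_eqF //; lra.
    by split; apply: flat_inj; rewrite ?fu ?fv ?fx ?fy eh em.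
  + case=> _ e; have := chain_height_ge0 m (odd h) t01.
    by have /andP[p0 _] := spoke_param kl' t01'; rewrite e oppr_ge0 leNgt p0.
  + case=> _ e; have := chain_height_ge0 m' (odd h') t01'.
    by have /andP[p0 _] := spoke_param kl t01; rewrite -e oppr_ge0 leNgt p0.
  + have /andP[_ p1] := spoke_param kl t01.
    move=> /(spoke_inj p1)[/(mulIf _)]; rewrite invr_eq0 pnatr_eq0 => /(_ isT) e ej.
    have ek := nat_frac_inj (frac01 _ t01) (frac01 _ t01') e.
    by split; apply: flat_inj; rewrite ?fu ?fv ?fx ?fy ej ek.
Qed.

End NecklacePlanar.

(** * Weight of one bundle *)

Section Weights.
Variables (R : realType) (q : nat).
Hypothesis q_gt0 : (0 < q)%N.

(** [theta_weight m] is the weight of the bundle being crossed when [m] of its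
[q * q] midpoints are in the tree.  It bounds the exponential moment
[E exp (tau / 2)] of the remaining crossing time [tau].  It falls linearly until
[m = q]; from then on there are enough edges leading to the next main vertex. *)
Definition theta_weight (m : nat) : R :=
  1 + q%:R^-1 + 4 * (q - m)%:R / q%:R ^+ 2.

Lemma theta_weight_ge1 m : 1 <= theta_weight m.
Proof. by rewrite /theta_weight -addrA lerDl addr_ge0 ?mulr_ge0 // invr_ge0. Qed.

Lemma theta_weight_le m n : (m <= n)%N -> theta_weight n <= theta_weight m.
Proof.
move=> mn; rewrite lerD2l ler_wpM2r ?invr_ge0 ?exprn_ge0 // ler_wpM2l //.
by rewrite ler_nat leq_sub2l.
Qed.

Lemma theta_weight0 : theta_weight 0 = 1 + 5 / q%:R.
Proof.
have q0 : q%:R != 0 :> R by rewrite pnatr_eq0 -lt0n.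
by rewrite /theta_weight subn0; field.
Qed.

(** Each of the [m] midpoints in the tree has an edge to the next main vertex, which
resets the weight to 1, and each of the others is reached from the current main
vertex.  For [m < q] the second kind of edges alone gives the decrease, for
[q <= m] the first kind alone.  In the first case there are at least
[3 / 4 * q ^ 2] such edges, each of which lowers the weight, at most [6], by
[4 / q ^ 2]. *)
Lemma theta_weight_drift m : (m <= q * q)%N ->
  m%:R * (1 - theta_weight m) +
    (q * q - m)%:R * (theta_weight m.+1 - theta_weight m) <=
  - (theta_weight m / 2).
Proof.
move=> mM; have q1 : 1 <= q%:R :> R by rewrite ler1n.
have q0 : q%:R != 0 :> R by rewrite pnatr_eq0 -lt0n.
have [qm|mq] := leqP q m.
  have wE n : (q <= n)%N -> theta_weight n = 1 + q%:R^-1.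
    by move=> /eqP qn; rewrite /theta_weight qn mulr0 mul0r addr0.
  have mq' : 1 <= m%:R / q%:R :> R by rewrite ler_pdivlMr ?mul1r ?ler_nat // ltr0n.
  have iq : q%:R^-1 <= 1 :> R by rewrite invf_le1 // ltr0n.
  rewrite !wE ?(leqW qm) // subrr mulr0 addr0.
  by rewrite opprD addNKr mulrN lerN2; lra.
have m0 : 0 <= m%:R :> R by [].
have mq' : m%:R + 1 <= q%:R :> R by rewrite natr1 ler_nat.
rewrite /theta_weight !natrB // ?(ltnW mq) // natrM -[m.+1%:R]natr1.
move: (q%:R : R) (m%:R : R) q0 q1 m0 mq' => Q y Q0 Q1 y0 yQ.
rewrite -subr_ge0.
have -> : - ((1 + Q^-1 + 4 * (Q - y) / Q ^+ 2) / 2) -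
  (y * (1 - (1 + Q^-1 + 4 * (Q - y) / Q ^+ 2)) +
   (Q * Q - y) *
   (1 + Q^-1 + 4 * (Q - (y + 1)) / Q ^+ 2 - (1 + Q^-1 + 4 * (Q - y) / Q ^+ 2)))
  = (7 * Q ^+ 2 - 5 * Q - 4 * y + 2 * (y * Q) + 8 * (y * (Q - y))) / (2 * Q ^+ 2).
  by field.
have h1 : y <= y * (Q - y) by rewrite ler_peMr //; lra.
have h2 : Q <= Q ^+ 2 by rewrite expr2 ler_peMr //; lra.
have h3 : 0 <= y * Q by rewrite mulr_ge0 //; lra.
by apply: divr_ge0; [lra | rewrite mulr_ge0 ?exprn_ge0 //; lra].
Qed.

End Weights.

(** * The potential *)

Section Potential.
Variables (R : realType) (L J S l q : nat).
Hypotheses (q_gt0 : (0 < q)%N).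
Notation M := (q * q)%N.
Notation node := (node L M J l).
Implicit Types (V W : {set node}) (x y : node) (a : node * node).

Definition middles (i : 'I_L) V : nat := #|[set m | Middle i m \in V]%SET|.

(** The factor 1 of a crossed bundle does not depend on its midpoints, which may
still join the tree later. *)
Definition theta_factor (i : 'I_L) V : R :=
  if Main (lift ord0 i) \in V then 1 else theta_weight R q (middles i V).

Definition necklace_weight V : R := \prod_i theta_factor i V.

Definition arm_length (j : 'I_J) V : nat := #|[set k | Arm j k \in V]%SET|.

Definition arms_weight V : R := \sum_j (3 / 2) ^+ arm_length j V.

Definition potential V : R := necklace_weight V * arms_weight V / (3 / 2) ^+ l.

(** The boundary edges depend on the tree only through its vertices. *)
Definition front V : {set node * node} :=
  [set a | [&& necklace_adj S a.1 a.2, a.1 \in V & a.2 \notin V]]%SET.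

Lemma theta_factor_ge1 i V : 1 <= theta_factor i V.
Proof. by rewrite /theta_factor; case: ifP => // _; apply: theta_weight_ge1. Qed.

Lemma theta_factor_le i V W : V \subset W -> theta_factor i W <= theta_factor i V.
Proof.
move=> VW; rewrite /theta_factor; case: ifPn => [_|nW]; first exact: theta_factor_ge1.
rewrite ifN; last by apply: contra nW; apply: (fintype.subsetP VW).
apply: theta_weight_le; apply: subset_leq_card; apply/fintype.subsetP => m.
by rewrite !finset.inE; apply: (fintype.subsetP VW).
Qed.

Lemma necklace_weight_le V W : V \subset W -> necklace_weight W <= necklace_weight V.
Proof.
move=> VW; apply: ler_prod => i _; rewrite theta_factor_le // andbT.
by rewrite (le_trans ler01) ?theta_factor_ge1.
Qed.

Lemma necklace_weight_ge1 V : 1 <= necklace_weight V.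
Proof.
have /(_ (index_enum 'I_L)) := @ler_prod R 'I_L _ xpredT (fun=> 1) (theta_factor^~ V).
by rewrite big1_eq; apply=> i _; rewrite ler01 theta_factor_ge1.
Qed.

Lemma arms_weight_ge0 V : 0 <= arms_weight V.
Proof. by apply: sumr_ge0 => j _; rewrite exprn_ge0 ?divr_ge0. Qed.

Lemma potential_ge0 V : 0 <= potential V.
Proof.
rewrite /potential divr_ge0 ?exprn_ge0 ?divr_ge0 // mulr_ge0 ?arms_weight_ge0 //.
exact: le_trans (necklace_weight_ge1 V).
Qed.

Lemma frontier_theta V : Main ord0 \in V -> Main ord_max \notin V ->
  exists i : 'I_L, Main (widen_ord (leqnSn L) i) \in V /\ Main (lift ord0 i) \notin V.
Proof.
move=> V0 VL; apply: contrapT => no; case/negP: VL.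
suff H k (kL : (k < L.+1)%N) : Main (Ordinal kL) \in V.
  by rewrite (_ : ord_max = Ordinal (ltnSn L)) //; apply: val_inj.
elim: k kL => [|k IH] kL; first by rewrite (_ : Ordinal kL = ord0) //; apply: val_inj.
apply: contrapT => /negP nV; apply: no; have kL' : (k < L)%N by [].
exists (Ordinal kL'); split.
  by rewrite (_ : widen_ord _ _ = Ordinal (ltnW kL)) //; apply: val_inj.
by rewrite (_ : lift _ _ = Ordinal kL) //; apply: val_inj.
Qed.

(** Every boundary edge can only lower the product, so it suffices to count the
edges of one bundle that has its first main vertex in the tree and not its
last. *)
Lemma necklace_weight_drift V : Main ord0 \in V -> Main ord_max \notin V ->
  \sum_(a in front V) (necklace_weight (a.2 |: V)%SET - necklace_weight V) <=
  - (necklace_weight V / 2).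
Proof.
move=> V0 VL; have [i [iV iV']] := frontier_theta V0 VL.
pose f m : node * node := if Middle i m \in V then (Middle i m, Main (lift ord0 i))
   else (Main (widen_ord (leqnSn L) i), Middle i m).
have f_inj : injective f by move=> m m'; rewrite /f; do 2 case: ifP => _; case.
pose delta a := necklace_weight (a.2 |: V)%SET - necklace_weight V.
have delta_le0 a : delta a <= 0.
  by rewrite subr_le0 necklace_weight_le // finset.subsetUr.
have f_front m : f m \in front V.
  rewrite finset.in_set /f; case: ifPn => mV /=.
    by rewrite mV iV' /necklace_adj /= eqxx.
  by rewrite mV iV /necklace_adj /= eqxx.
apply: (@le_trans _ _ (\sum_(a in f @: [set: 'I_M]%SET) delta a)).
  rewrite big_mkcond [leRHS]big_mkcond; apply: ler_sum => a _.
  case: ifP => aV; case: ifP => // af; first exact: delta_le0.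
  by case/imsetP: af aV => m _ ->; rewrite f_front.
rewrite big_imset /=; last by move=> m m' _ _; apply: f_inj.
rewrite (eq_bigl xpredT); last by move=> m; rewrite finset.in_setT.
pose rest V := \prod_(i' < L | i' != i) theta_factor i' V.
have weightE W : necklace_weight W = theta_factor i W * rest W.
  by rewrite /necklace_weight (bigD1 i).
set k := middles i V; set w := theta_weight R q.
have fV : theta_factor i V = w k by rewrite /theta_factor (negPf iV').
have restE m : rest ((f m).2 |: V)%SET = rest V.
  apply: eq_bigr => i' ne; rewrite /theta_factor.
  have -> : (Main (lift ord0 i') \in ((f m).2 |: V)%SET) = (Main (lift ord0 i') \in V).
    rewrite finset.in_setU1 /f; case: ifP => _ //=.
    by rewrite -[_ == _]/(lift ord0 i' == lift ord0 i) (inj_eq lift_inj) (negPf ne).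
  suff -> : middles i' ((f m).2 |: V)%SET = middles i' V by [].
  apply: eq_card => m'; rewrite !finset.in_set finset.in_set1 /f.
  case: ifP => _ //=; case: eqP => // -[e _]; by rewrite e eqxx in ne.
have factorE m : theta_factor i ((f m).2 |: V)%SET =
    if Middle i m \in V then 1 else w k.+1.
  rewrite /theta_factor /f; have [mV|mV] := boolP (Middle i m \in V) => /=.
    by rewrite finset.setU11.
  rewrite finset.in_setU1 (negPf iV') /=; congr (theta_weight _ _ _).
  rewrite /middles (_ : [set _ | _]%SET = m |: [set m | Middle i m \in V])%SET.
    by rewrite cardsU1 finset.inE mV.
  apply/setP => m'; rewrite !finset.in_set !finset.in_set1; congr orb.
  by apply/eqP/eqP => [[]|->].
have rest_ge0 : 0 <= rest V.
  by apply: prodr_ge0 => i' _; apply: le_trans (theta_factor_ge1 _ _).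
under eq_bigr => m _.
  rewrite /delta !weightE restE -mulrBl factorE fV.
  rewrite (_ : _ - _ = if Middle i m \in V then 1 - w k else w k.+1 - w k); last first.
    by case: ifP.
  over.
rewrite -mulr_suml weightE fV mulrAC -mulNr ler_wpM2r //.
pose A := [set m | Middle i m \in V]%SET.
rewrite (bigID (mem A)) /=.
rewrite (eq_bigr (fun=> 1 - w k)); last by move=> m; rewrite finset.in_set => ->.
rewrite [X in _ + X](eq_bigr (fun=> w k.+1 - w k)); last first.
  by move=> m; rewrite finset.in_set => /negPf->.
rewrite sumr_const [X in _ + X](eq_bigl (mem (~: A)%SET)); last first.
  by move=> m; rewrite /= finset.in_setC.
rewrite sumr_const [X in _ + _ *+ X]cardsCs finset.setCK card_ord -/k.
rewrite -[_ *+ _]mulr_natl -[X in _ + X]mulr_natl.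
apply: theta_weight_drift => //.
by rewrite -[leqRHS]card_ord max_card.
Qed.

(** As long as the hub is not in the tree, arms are entered from the chain only, and
the tree contains an initial segment of each of them. *)
Definition arms_closed V := forall (j : 'I_J) (k k' : 'I_l),
  (k <= k')%N -> Arm j k' \in V -> Arm j k \in V.

Lemma frontP V a :
  reflect [/\ necklace_adj S a.1 a.2, a.1 \in V & a.2 \notin V] (a \in front V).
Proof. by rewrite finset.in_set; apply: and3P. Qed.

Lemma arm_entry V a j k : arms_closed V -> Hub \notin V -> a \in front V ->
  a.2 = Arm j k ->
  flat a.1 = if k == 0%N :> nat then (0, j * S, 0)%N else (2, j : nat, k.-1)%N.
Proof.
move=> clV nH /frontP[]; case: a => x y /= + xV + ey; rewrite ey => xy nV.
move: xy xV; rewrite /necklace_adj; case: x => [i|i m|j' k'|] //=.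
- by rewrite orbF => /andP[/eqP-> ->].
- case/orP=> /andP[/eqP-> /eqP kE].
    by rewrite kE.
  by move=> k'V; rewrite (clV j k k') ?kE in nV.
- by move=> _; rewrite (negPf nH).
Qed.

Lemma arm_entry_prefix V a j k : arms_closed V -> Hub \notin V -> a \in front V ->
  a.2 = Arm j k -> forall k' : 'I_l, (k' < k)%N -> Arm j k' \in V.
Proof.
move=> clV nH aV ea k' k'k; have := arm_entry clV nH aV ea.
have [_ xV _] := frontP _ _ aV.
rewrite gtn_eqF ?(leq_ltn_trans _ k'k) //.
case: a.1 xV => [i|i m|j1 k1|] //= xV [/ord_inj ej ek].
by rewrite -ej; apply: clV xV; rewrite ek -ltnS prednK // (leq_ltn_trans _ k'k).
Qed.

Lemma arms_closedU V a : arms_closed V -> Hub \notin V -> a \in front V ->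
  arms_closed (a.2 |: V)%SET.
Proof.
move=> clV nH aV j k k' kk' /setU1P[ea|k'V]; apply/setU1P; last first.
  by right; apply: clV kk' k'V.
have [lt|ge] := ltnP k k'; first by right; apply: (arm_entry_prefix clV nH aV (esym ea)).
by left; rewrite -ea; congr Arm; apply/ord_inj/eqP; rewrite eqn_leq kk' ge.
Qed.

Definition in_arm (j : 'I_J) x : bool := if x is Arm j' _ then j' == j else false.

(** A path explored from one end has at most one boundary edge. *)
Lemma arm_entry_unique V j : arms_closed V -> Hub \notin V ->
  (#|[set a in front V | in_arm j a.2]%SET| <= 1)%N.
Proof.
move=> clV nH; apply/card_le1P => a; rewrite finset.inE => /andP[aV ja] b.
rewrite [RHS]inE finset.inE; apply/idP/eqP => [/andP[bV jb]|->]; last by rewrite aV.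
case ea: a.2 ja => [||j1 k|] //= /eqP ej; case eb: b.2 jb => [||j2 k'|] //= /eqP ej'.
rewrite {}ej {}ej' in ea eb.
have [_ _ na] := frontP _ _ aV; have [_ _ nb] := frontP _ _ bV.
have ek : k = k'.
  apply: ord_inj; have [lt|lt|//] := ltngtP k k'.
    by rewrite ea (arm_entry_prefix clV nH bV eb lt) in na.
  by rewrite eb (arm_entry_prefix clV nH aV ea lt) in nb.
rewrite (surjective_pairing a) (surjective_pairing b) ea eb ek; congr pair.
apply: flat_inj; rewrite (arm_entry clV nH aV ea) (arm_entry clV nH bV eb).
by rewrite ek.
Qed.

Lemma arm_lengthU V y j : y \notin V ->
  arm_length j (y |: V)%SET = (in_arm j y + arm_length j V)%N.
Proof.
move=> yV; rewrite /arm_length; case: y yV => [i|i m|j' k|] yV /=;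
  try by apply: eq_card => k'; rewrite !finset.in_set finset.in_set1.
have [ej|ne] := eqVneq j' j; last first.
  apply: eq_card => k'; rewrite !finset.in_set finset.in_set1.
  by case: eqP => // -[e]; rewrite e eqxx in ne.
rewrite ej in yV *.
rewrite (_ : [set _ | _]%SET = k |: [set k | Arm j k \in V])%SET.
  by rewrite cardsU1 finset.in_set yV.
apply/setP => k'; rewrite !finset.in_set !finset.in_set1; congr orb.
by apply/eqP/eqP => [[]|->].
Qed.

Lemma arms_weight_drift V : arms_closed V -> Hub \notin V ->
  \sum_(a in front V) (arms_weight (a.2 |: V)%SET - arms_weight V) <=
  arms_weight V / 2.
Proof.
move=> clV nH; rewrite /arms_weight.
under eq_bigr do rewrite -sumrB.
rewrite exchange_big /= mulr_suml; apply: ler_sum => j _.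
rewrite (eq_bigr (fun a => if in_arm j a.2 then
    (3 / 2) ^+ arm_length j V / 2 else 0)); last first.
  move=> a /frontP[_ _ aV]; rewrite arm_lengthU //.
  case: ifP => _; last by rewrite subrr.
  by rewrite add1n exprS; move: (_ ^+ arm_length j V) => z; lra.
rewrite -big_mkcondr /= (eq_bigl (mem [set a in front V | in_arm j a.2]%SET)); last first.
  by move=> a; rewrite /= [RHS]finset.in_set.
rewrite sumr_const -[leLHS]mulr_natl ler_piMl //.
by rewrite -[leRHS]/1%:R ler_nat arm_entry_unique.
Qed.

(** The two relative drifts, [- 1 / 2] and [1 / 2], cancel; the product of the two
increments of a single step is nonpositive since they have opposite signs. *)
Lemma potential_drift V : Main ord0 \in V -> Main ord_max \notin V ->
  arms_closed V -> Hub \notin V ->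
  \sum_(a in front V) (potential (a.2 |: V)%SET - potential V) <= 0.
Proof.
move=> V0 VL clV nH.
have c0 : 0 < (3 / 2) ^+ l :> R by rewrite exprn_gt0.
rewrite /potential; under eq_bigr do rewrite -mulrBl.
rewrite -mulr_suml pmulr_lle0 ?invr_gt0 //.
apply: (@le_trans _ _ (\sum_(a in front V)
  ((necklace_weight (a.2 |: V)%SET - necklace_weight V) * arms_weight V +
   necklace_weight V * (arms_weight (a.2 |: V)%SET - arms_weight V)))).
  apply: ler_sum => a /frontP[_ _ aV].
  set w := necklace_weight V; set X := arms_weight V.
  have hw : necklace_weight (a.2 |: V)%SET <= w.
    by apply: necklace_weight_le; apply: finset.subsetUr.
  have hX : X <= arms_weight (a.2 |: V)%SET.
    apply: ler_sum => j _; rewrite arm_lengthU // ler_eXn2l ?leq_addl //.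
    lra.
  rewrite -subr_ge0; set w' := necklace_weight _ in hw *; set X' := arms_weight _ in hX *.
  rewrite [X in 0 <= X](_ : _ = (w - w') * (X' - X)); last by ring.
  by rewrite mulr_ge0 ?subr_ge0.
rewrite big_split /= -mulr_suml -mulr_sumr.
have h1 := ler_wpM2r (arms_weight_ge0 V) (necklace_weight_drift V0 VL).
have w0 : 0 <= necklace_weight V by apply: le_trans (necklace_weight_ge1 V).
have h2 := ler_wpM2l w0 (arms_weight_drift clV nH).
by apply: (le_trans (lerD h1 h2)); rewrite mulNr mulrAC mulrA addNr.
Qed.

(** The hub is entered from the last vertex of an arm, all of which is then in the
tree. *)
Lemma potential_hub V a : arms_closed V -> Hub \notin V -> a \in front V ->
  a.2 = Hub -> 1 <= potential (a.2 |: V)%SET.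
Proof.
move=> clV nH aV ea; have [+ xV _] := frontP _ _ aV; rewrite ea /necklace_adj.
case: a.1 xV => [i|i m|j k|] //= xV; rewrite orbF => /eqP kl.
have c0 : 0 < (3 / 2) ^+ l :> R by rewrite exprn_gt0.
rewrite /potential ler_pdivlMr // mul1r.
have full : arm_length j (Hub |: V)%SET = l.
  rewrite arm_lengthU // add0n /arm_length -[RHS]card_ord -cardsT; congr #|pred_of_set _|.
  apply/setP => k'; rewrite !finset.in_set; apply: clV xV.
  by rewrite -ltnS kl.
apply: (@le_trans _ _ (arms_weight (Hub |: V)%SET)); last first.
  by rewrite ler_peMl ?arms_weight_ge0 ?necklace_weight_ge1.
by rewrite /arms_weight (bigD1 j) //= full lerDl sumr_ge0.
Qed.

Lemma potential_start :
  potential [set Main ord0]%SET = J%:R * (1 + 5 / q%:R) ^+ L / (3 / 2) ^+ l.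
Proof.
rewrite /potential; congr (_ / _); rewrite mulrC; congr (_ * _).
  rewrite /arms_weight (eq_bigr (fun=> 1)); first by rewrite sumr_const card_ord.
  move=> j _; rewrite /arm_length (_ : [set _ | _]%SET = finset.set0) ?cards0 //.
  by apply/setP => k; rewrite finset.in_set finset.in_set1 finset.in_set0.
rewrite /necklace_weight (eq_bigr (fun=> 1 + 5 / q%:R)).
  by rewrite prodr_const card_ord.
move=> i _; rewrite /theta_factor.
have -> : (Main (lift ord0 i) \in [set Main ord0 : node]%SET) = false.
  by rewrite finset.in_set1; apply/eqP; case.
rewrite -theta_weight0 //; congr (theta_weight _ _ _).
rewrite /middles (_ : [set _ | _]%SET = finset.set0) ?cards0 //.
by apply/setP => k; rewrite finset.in_set finset.in_set1 finset.in_set0.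
Qed.

End Potential.

(** * The long path *)

Section LongPath.
Variables (R : realType) (L J S l q : nat).
Hypotheses (q_gt0 : (0 < q)%N) (M_gt0 : (0 < q * q)%N).
Hypotheses (l_gt0 : (0 < l)%N) (LJS : L.+1 = (J * S)%N).
Notation node := (node L (q * q) J l).
Notation G := (necklace M_gt0 l_gt0 LJS).
Notation s := (Main ord0 : G).
Implicit Types (T : {set G * G}).

(** A function that changes by at most 1 along every edge not incident to the hub,
so that leaving the hub aside, the ends of the chain are at distance [L.*2]. *)
Definition level (x : node) : nat :=
  match x with
  | Main i => i.*2
  | Middle i _ => i.*2.+1
  | Arm j _ => (j * S).*2
  | Hub => 0
  end.

Lemma level_adj (x y : node) : necklace_adj S x y -> x != Hub -> y != Hub ->
  (level y <= (level x).+1)%N.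
Proof.
rewrite /necklace_adj; case: x y => [i|i m|j k|] [i'|i' m'|j' k'|] //=;
  rewrite ?orbF => + _ _.
- by case/orP=> /eqP; lia.
- by case/andP=> /eqP->.
- by case/orP=> /eqP; lia.
- by case/andP=> /eqP->.
- by case/orP=> /andP[/eqP->].
Qed.

Lemma level_path (x : node) p :
  path (@necklace_adj L (q * q) J S l) x p -> Hub \notin x :: p ->
  (level (last x p) <= level x + size p)%N.
Proof.
elim: p x => [|y p IH] x /=; first by rewrite addn0.
move=> /andP[xy pp]; rewrite !inE !negb_or => /and3P[xH yH pH].
apply: leq_trans (IH y pp _) _; first by rewrite inE negb_or yH.
rewrite addnS -addSn leq_add2r level_adj // eq_sym //.
Qed.

Definition long_tree T : bool :=
  [exists p : (L.*2).-tuple G, path (fun u v => (u, v) \in T) s p].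

Lemma long_treeU T a : long_tree T -> long_tree (a |: T)%SET.
Proof.
case/existsP=> p pp; apply/existsP; exists p; apply: sub_path pp => u v uv.
by rewrite finset.in_setU1 uv orbT.
Qed.

Lemma long_tree_height i T : grown s i T -> (i < #|G|)%N -> long_tree T ->
  (L.*2 <= height s T)%N.
Proof.
move=> gT iG /existsP[p pp].
by have := path_le_height gT iG pp; rewrite size_tuple.
Qed.

Lemma end_reached_long i T : grown s i T -> Main ord_max \in tree_vertices s T ->
  Hub \notin tree_vertices s T -> long_tree T.
Proof.
move=> gT /(grown_path gT)[p pp lp] nH.
have adjp : path (@necklace_adj L (q * q) J S l) s p.
  by apply: sub_path pp => u v; apply: (grown_adj gT).
have Hp : Hub \notin s :: p.
  by rewrite in_cons negb_or /=; apply: contra nH => /(tree_path_vertices pp).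
have := level_path adjp Hp; rewrite lp /= => szp.
have sz : size (take L.*2 p) == L.*2 by rewrite size_take_min; apply/eqP/minn_idPl.
apply/existsP; exists (Tuple sz) => /=.
by move: pp; rewrite -{1}(cat_take_drop L.*2 p) cat_path => /andP[].
Qed.

Lemma grown_arms_closed i T : grown s i T -> Hub \notin tree_vertices s T ->
  arms_closed (tree_vertices s T : {set node}).
Proof.
elim=> [_|{}i {}T a gT IH aT].
  by rewrite tree_vertices0 => j k k' _; rewrite finset.in_set1.
rewrite tree_verticesU finset.in_setU1 negb_or => /andP[_ nH].
exact: (arms_closedU (IH nH) nH aT).
Qed.

(** A lower bound for the conditional probability that the final tree is long: it is
1 once the tree is long, and is given up when the hub comes first. *)
Definition success_bound T : R :=
  if long_tree T then 1 else if (Hub : G) \in tree_vertices s T then 0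
  else 1 - potential R (tree_vertices s T : {set node}).

Lemma success_bound_submartingale i T : grown s i T ->
  #|boundary s T|%:R * success_bound T <=
    \sum_(a in boundary s T) success_bound (a |: T)%SET.
Proof.
move=> gT; rewrite {1}/success_bound.
have [longT|nlong] := boolP (long_tree T).
  rewrite (eq_bigr (fun=> 1)); first by rewrite sumr_const mulr1.
  by move=> a _; rewrite /success_bound long_treeU.
case: ifPn => [HT|nH].
  rewrite mulr0; apply: sumr_ge0 => a _; rewrite /success_bound.
  by case: ifP => // _; rewrite tree_verticesU finset.in_setU1 HT orbT.
have VL : Main ord_max \notin tree_vertices s T.
  by apply: contra nlong => VL; apply: (end_reached_long gT).
have clV := grown_arms_closed gT nH.
set V : {set node} := tree_vertices s T.
apply: (@le_trans _ _ (\sum_(a in front S V) (1 - potential R (a.2 |: V)%SET))).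
  have := potential_drift R S q_gt0 (root_in_tree s T) VL clV nH.
  by rewrite !sumrB !sumr_const mulr_natl mulrnBl lerD2l lerN2 subr_le0.
apply: ler_sum => a aT; rewrite /success_bound tree_verticesU.
have p0 := potential_ge0 R (a.2 |: V)%SET.
case: ifP => _; first by rewrite gerBl.
case: ifPn => //; rewrite finset.in_setU1 (negPf nH) orbF => /eqP eH.
by rewrite subr_le0 (potential_hub R clV nH aT).
Qed.

(** The final tree contains the hub, so there [success_bound] is the indicator
function of long trees. *)
Lemma prob_high_ge (E : pred {set G * G}) :
  (forall T, (L.*2 <= height s T)%N -> E T) ->
  1 - J%:R * (1 + 5 / q%:R) ^+ L / (3 / 2) ^+ l <= prob_spanning_tree R s E.
Proof.
move=> hE; rewrite -(potential_start R L J l q_gt0).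
have start : 1 - potential R [set Main ord0 : node]%SET <= success_bound finset.set0.
  rewrite /success_bound tree_vertices0 finset.in_set1 /=.
  by case: ifP => // _; rewrite gerBl potential_ge0.
apply: (le_trans start); apply: submartingale_prob => [i T|T gT].
  exact: success_bound_submartingale.
have n0 : (0 < #|G|)%N by apply/card_gt0P; exists s.
rewrite /success_bound; case: ifP => [longT|_].
  by rewrite hE // (long_tree_height gT) // prednK.
rewrite ifT //; have := card_grown gT; rewrite prednK // => cV.
have /eqP -> : tree_vertices s T == [set: G]%SET.
  by rewrite eqEcard finset.subsetT cardsT cV /=; apply: leqnn.
by rewrite finset.in_setT.
Qed.

End LongPath.

(** * Choice of the parameters *)

(** The largest [q] with room for two bundles of [q * q] paths, and for an arm unless
[q = 1], at each vertex. *)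
Lemma theta_size_exists Delta : (1 < Delta)%N -> exists q,
  [/\ (0 < q)%N, ((q * q).*2 + (1 < q) <= Delta)%N & (Delta <= 12 * (q * q))%N].
Proof.
move=> D1; pose P q := ((0 < q) && ((q * q).*2 + (1 < q) <= Delta))%N.
have exP : exists q, P q by exists 1%N; rewrite /P; lia.
have ubP q : P q -> (q <= Delta)%N by case/andP=> q0 h; nia.
case: (ex_maxnP exP ubP) => q /andP[q0 qD] qmax; exists q; split=> //.
have : ~~ P q.+1 by apply/negP => /qmax; rewrite ltnn.
rewrite /P /= -ltnNge ltnS q0; nia.
Qed.

Lemma divn_floor (R : realType) (m d : nat) : (0 < d)%N ->
  m%:R / d%:R - 1 <= ((m %/ d)%:R : R) <= m%:R / d%:R.
Proof.
move=> d0; have d0' : 0 < d%:R :> R by rewrite ltr0n.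
rewrite lerBlDr ler_pdivrMr // ler_pdivlMr // natr1 -!natrM !ler_nat leq_divM andbT.
by rewrite ltnW ?ltn_ceil.
Qed.

Section Estimates.
Variable R : realType.

Lemma inv_cvg0 : (2 + `|x|)^-1 @[x --> +oo] --> (0 : R).
Proof.
apply/gtr0_cvgV0; first by near=> x; rewrite ltr_pwDl.
apply: (@ger_cvgy _ _ _ _ id); last exact: cvg_id.
by near=> x; rewrite (le_trans (ler_norm x)) // lerDr.
Unshelve. all: by end_near. Qed.

Variables (Delta D : nat).
Hypotheses (Delta_gt1 : (1 < Delta)%N).
Hypothesis D_large : 10%:R ^+ 6 * ln (Delta%:R : R) <= D%:R.

Lemma ln2_ge_half : 1 / 2 <= ln (2 : R).
Proof.
rewrite -ler_expR lnK ?posrE // -lef_pV2 ?posrE ?expR_gt0 // -expRN.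
by apply: le_trans (expR_ge1Dx _); lra.
Qed.

Lemma ln_Delta_le : ln (Delta%:R : R) <= D%:R / 1000.
Proof.
have h : 0 <= ln (Delta%:R : R) by rewrite ln_ge0 // ler1n ltnW.
by move: h D_large; move: (ln _) (D%:R : R) => x d; lra.
Qed.

(** The square of 80 is what [D_le_exp] requires. *)
Lemma D_ge : 80 * 80 <= D%:R :> R.
Proof.
have h2 := ln2_ge_half.
have hln : ln (2 : R) <= ln Delta%:R by rewrite ler_ln ?posrE ?ler_nat ?ltr0n ?(ltnW Delta_gt1).
by move: h2 hln D_large; move: (ln _) (ln _) (D%:R : R) => x y d; lra.
Qed.

Lemma Delta_le_exp : Delta%:R <= expR (D%:R / 1000 : R).
Proof.
rewrite -[leLHS]lnK ?posrE ?ltr0n ?(ltnW Delta_gt1) // ler_expR.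
exact: ln_Delta_le.
Qed.

Lemma D_le_exp : D%:R <= expR (D%:R / 40 : R).
Proof.
have hD := D_ge; move: (D%:R : R) hD => x hD.
have -> : x / 40 = x / 80 + x / 80 by lra.
have h := expR_ge1Dx (x / 80); rewrite expRD.
have x0 : 0 <= x / 80 by lra.
have : (x / 80) * (x / 80) <= expR (x / 80) * expR (x / 80).
  by apply: ler_pM => //; lra.
apply: le_trans; rewrite mulrACA -invfM ler_pdivlMr // ler_wpM2l //; lra.
Qed.

Variables (q L : nat).
Hypotheses (q_gt0 : (0 < q)%N) (q_le : (q <= Delta)%N).
Hypothesis LqS : L.+1 = (q * (D %/ 200))%N.

Let L_le : L%:R <= q%:R * (D%:R / 200) :> R.
Proof.
apply: (@le_trans _ _ L.+1%:R); first by rewrite ler_nat.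
by rewrite LqS natrM ler_wpM2l //; have /andP[] := divn_floor R D (isT : 0 < 200)%N.
Qed.

Let q_le_exp : q%:R <= expR (D%:R / 1000 : R).
Proof. by apply: le_trans Delta_le_exp; rewrite ler_nat. Qed.

(** Here [1 + 5 / q <= exp (5 / q)] and [exp (1 / 3) <= 3 / 2], so that up to a
constant the exponent is at most [D * (1 / 1000 + 1 / 40 - 1 / 12)]; this is where
arms that are long compared with the segments win. *)
Lemma failure_le :
  q%:R * (1 + 5 / q%:R) ^+ L / (3 / 2) ^+ (D %/ 4) <= expR (- (D%:R / 20)) :> R.
Proof.
have q0 : 0 < q%:R :> R by rewrite ltr0n.
have chain : (1 + 5 / q%:R) ^+ L <= expR (D%:R / 40) :> R.
  apply: (@le_trans _ _ (expR (5 / q%:R) ^+ L)).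
    by rewrite lerXn2r ?nnegrE ?expR_ge0 ?expR_ge1Dx // addr_ge0 // divr_ge0 // ltW.
  rewrite -expRM_natr ler_expR mulrAC ler_pdivrMr //.
  by move: L_le; move: (L%:R : R) (q%:R : R) (D%:R : R) => x y z; lra.
have arms : expR (D%:R / 12 - 1 / 3) <= (3 / 2) ^+ (D %/ 4) :> R.
  have h3 : expR (1 / 3) <= 3 / 2 :> R.
    rewrite -lef_pV2 ?posrE ?expR_gt0 // -expRN.
    by apply: le_trans (expR_ge1Dx _); lra.
  apply: (@le_trans _ _ (expR (1 / 3) ^+ (D %/ 4))); last first.
    by rewrite lerXn2r ?nnegrE ?expR_ge0.
  rewrite -expRM_natr ler_expR.
  have /andP[+ _] := divn_floor R D (isT : 0 < 4)%N.
  by move: (D%:R : R) (_%:R : R) => x y; lra.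
have a0 : 0 < (3 / 2) ^+ (D %/ 4) :> R by rewrite exprn_gt0.
rewrite ler_pdivrMr //.
apply: (@le_trans _ _ (expR (D%:R / 1000) * expR (D%:R / 40))).
  by apply: ler_pM => //; rewrite ?exprn_ge0 ?addr_ge0 ?divr_ge0 // ltW.
apply: le_trans (ler_wpM2l (expR_ge0 _) arms).
rewrite -!expRD ler_expR.
by have := D_ge; move: (D%:R : R) => x; lra.
Qed.

(** A polynomial in [Delta] times [D] is below [exp (D / 20)]. *)
Lemma vertices_le :
  (L.+1 + (L * (q * q) + (q * (D %/ 4) + 1)))%:R + 2 <= expR (D%:R / 20) :> R.
Proof.
apply: (@le_trans _ _ (q%:R * (q%:R * q%:R) * D%:R)).
  rewrite -!natrM -natrD ler_nat.
  have D_gt0 : (12 <= D)%N.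
    by rewrite -(ler_nat R); move: D_ge; move: (D%:R : R) => x; lra.
  have LS := LqS; set S := (D %/ 200)%N in LS *; set l := (D %/ 4)%N.
  have hSl : (2 * S + l + 3 <= D)%N by rewrite /S /l; lia.
  have q3 : (q <= q * (q * q))%N by rewrite leq_pmulr // muln_gt0 q_gt0.
  have h1 : (L * (q * q) <= q * (q * q) * S)%N.
    by rewrite mulnAC leq_mul2r -LS leqnSn orbT.
  have h2 : (q * S <= q * (q * q) * S)%N by rewrite leq_mul2r q3 orbT.
  have h3 : (q * l <= q * (q * q) * l)%N by rewrite leq_mul2r q3 orbT.
  have h4 : (q * (q * q) * (2 * S + l + 3) <= q * (q * q) * D)%N.
    by rewrite leq_mul2l hSl orbT.
  have h5 : (1 <= q * (q * q))%N by apply: leq_trans q3.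
  by move: h4; rewrite !mulnDr LS; move: h1 h2 h3 h5; lia.
apply: (@le_trans _ _ (expR (D%:R / 1000) * (expR (D%:R / 1000) * expR (D%:R / 1000))
                       * expR (D%:R / 40))).
  by rewrite !ler_pM ?mulr_ge0 // D_le_exp.
rewrite -!expRD ler_expR.
by have := D_ge; move: (D%:R : R) => x; lra.
Qed.

Lemma height_target_lt c n : 0 <= c -> c <= 1 / 500 :> R ->
  (Delta <= 12 * (q * q))%N -> (0 < n)%N ->
  n%:R <= expR (D%:R / 20 : R) ->
  c * Num.sqrt Delta%:R * (D%:R + ln (n%:R : R)) < L.*2%:R.
Proof.
move=> c0 c1 Dq n0 nD; have q1 : 1 <= q%:R :> R by rewrite ler1n.
have sq : Num.sqrt Delta%:R <= 4 * q%:R :> R.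
  rewrite -[leRHS]ger0_norm ?mulr_ge0 // -sqrtr_sqr ler_wsqrtr //.
  have : Delta%:R <= 12 * (q%:R * q%:R) :> R by rewrite -!natrM ler_nat.
  have : 0 <= q%:R * q%:R :> R by rewrite mulr_ge0.
  by rewrite expr2; move: (q%:R : R) (Delta%:R : R) => x y; lra.
have lnn : ln (n%:R : R) <= D%:R / 20 by rewrite -ler_expR lnK ?posrE ?ltr0n.
have ln0 : 0 <= ln (n%:R : R) by rewrite ln_ge0 ?ler1n.
have hD := D_ge.
have /andP[hS _] := divn_floor R D (isT : 0 < 200)%N.
have hL : L%:R + 1 = q%:R * (D %/ 200)%:R :> R by rewrite natr1 LqS natrM.
apply: (@le_lt_trans _ _ (1 / 500 * (4 * q%:R) * (D%:R + D%:R / 20))).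
  apply: ler_pM; rewrite ?lerD2l ?addr_ge0 ?mulr_ge0 ?sqrtr_ge0 //.
  exact: ler_pM.
rewrite -muln2 natrM.
have := ler_wpM2l (ler0n R q) hS; rewrite -hL.
have : q%:R * (80 * 80) <= q%:R * D%:R :> R by rewrite ler_wpM2l.
by move: (q%:R : R) (L%:R : R) (D%:R : R) q1 => x y z; lra.
Qed.

End Estimates.

Theorem theorem8 (R : realType) :
  exists c : R, 0 < c /\
  exists f : R -> R,
    [/\ f x @[x --> +oo] --> (0 : R),
        forall x : R, f x < 1 &
        forall Delta D : nat,
          (1 < Delta)%N ->
          10%:R ^+ 6 * ln (Delta%:R : R) <= D%:R ->
          exists (G : graph) (s : G),
            [/\ planar R G,
                (diameter G <= D)%N,
                (max_degree G <= Delta)%N &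
                1 - f #|G|%:R <=
                prob_spanning_tree R s (fun T =>
                  c * Num.sqrt Delta%:R * (D%:R + ln (#|G|%:R : R))
                    < (height s T)%:R)]].
Proof.
exists (1 / 500); split; first by lra.
exists (fun x => (2 + `|x|)^-1); split; first exact: inv_cvg0.
  move=> x; have h : 1 < 2 + `|x| by rewrite ltr_wpDr // ltr1n.
  by rewrite invf_lt1 // (lt_trans ltr01).
move=> Delta D Delta1 Dlarge.
have [q [q0 qDelta Deltaq]] := theta_size_exists Delta1.
have D200 : (400 <= D)%N.
  rewrite -(ler_nat R); move: (D_ge Delta1 Dlarge).
  by move: (D%:R : R) => x; lra.
have M0 : (0 < q * q)%N by rewrite muln_gt0 q0.
have l0 : (0 < D %/ 4)%N by lia.
have [L LqS] : exists L, L.+1 = (q * (D %/ 200))%N.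
  by exists (q * (D %/ 200)).-1; rewrite prednK // muln_gt0 q0 divn_gt0 //; lia.
have q_le : (q <= Delta)%N by nia.
exists (necklace M0 l0 LqS), (Main ord0); split.
- exact: planar_necklace.
- by apply: leq_trans (diameter_necklace _ _ _) _; lia.
- by apply: max_degree_necklace.
have cardG : #|necklace M0 l0 LqS| = (L.+1 + (L * (q * q) + (q * (D %/ 4) + 1)))%N.
  exact: card_node.
have nle := vertices_le Delta1 Dlarge q0 q_le LqS; rewrite -cardG in nle.
apply: le_trans (prob_high_ge R q0 _) => [|T hT].
  rewrite lerD2l lerN2; apply: (le_trans (failure_le Delta1 Dlarge q0 q_le LqS)).
  rewrite expRN lef_pV2 ?posrE ?expR_gt0 ?ltr_pwDl //.
  by rewrite addrC ger0_norm.
apply: lt_le_trans (_ : L.*2%:R <= _); last by rewrite ler_nat.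
apply: (height_target_lt Delta1 Dlarge q0 LqS);
  [lra | exact: lexx | exact: Deltaq | by rewrite cardG |].
by apply: le_trans nle; rewrite lerDl.
Qed.
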